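(* Let $X$ be a $G$-space and let $f:X\rightarrow X$ be continuous. If $f$ is strongly $G$-mixing, then $f$ is totally $G$-transitive.
   Context: A $G$-space $X$ is a topological space $X$ together with a topological group $G$ and a continuous action $G\times X\to X$, $(g,x)\mapsto g.x$. For $A\subseteq X$, $g.A=\{g.a:a\in A\}$. $\mathbb{N}$ is the set of positive integers and $f^k$ is the $k$-th iterate of $f$. A continuous map $f:X\to X$ is strongly $G$-mixing if for any pair of nonempty open subsets $U,V$ of $X$ there exists $N\in\mathbb{N}$ such that for all $n\geqslant N$ there is $g_n\in G$ with $g_n.f^n(U)\cap V\neq\emptyset$. A continuous map $f:X\to X$ is $G$-transitive if for any pair of nonempty open subsets $U,V$ of $X$ there exist $g\in G$ and $k\in\mathbb{N}$ with $g.f^k(U)\cap V\neq\emptyset$. It is totally $G$-transitive if $f^n$ is $G$-transitive for every $n\geqslant 1$. *)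

(* Defs.v *)
From HB Require Import structures.
From mathcomp Require Import all_boot.
From mathcomp Require Import all_classical topology.

Set Implicit Arguments.
Unset Strict Implicit.
Unset Printing Implicit Defensive.

Local Open Scope classical_set_scope.

#[short(type="preTopologicalGroupType")]
HB.structure Definition PreTopologicalGroup := {G of Topological G & Group G}.

(* No separation axiom is required. *)
HB.mixin Record PreTopologicalGroup_isTopologicalGroup G
    of PreTopologicalGroup G := {
  mulg_continuous : continuous (fun p : G * G => (p.1 * p.2)%g);
  invg_continuous : continuous (fun g : G => (g^-1)%g)
}.

#[short(type="topologicalGroupType")]
HB.structure Definition TopologicalGroup :=
  {G of PreTopologicalGroup_isTopologicalGroup G & PreTopologicalGroup G}.

(* Left actions, unlike the right actions of mathcomp's action.v. *)
HB.mixin Record Topological_isGSpace (G : topologicalGroupType) X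
    of Topological X := {
  gact : G -> X -> X;
  gact1 : forall x : X, gact 1%g x = x;
  gactM : forall (g h : G) (x : X), gact (g * h)%g x = gact g (gact h x);
  gact_continuous : continuous (fun p : G * X => gact p.1 p.2)
}.

#[short(type="gSpaceType")]
HB.structure Definition GSpace (G : topologicalGroupType) :=
  {X of Topological_isGSpace G X & Topological X}.

Definition strongly_G_mixing (G : topologicalGroupType) (X : gSpaceType G)
    (f : X -> X) : Prop :=
  forall U V : set X, open U -> U !=set0 -> open V -> V !=set0 ->
    exists2 N : nat, (0 < N)%N &
      forall n : nat, (N <= n)%N ->
        exists g : G, (gact g @` (iter n f @` U)) `&` V !=set0.

Definition G_transitive (G : topologicalGroupType) (X : gSpaceType G)
    (f : X -> X) : Prop :=
  forall U V : set X, open U -> U !=set0 -> open V -> V !=set0 ->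
    exists (g : G) (k : nat),
      (0 < k)%N /\ (gact g @` (iter k f @` U)) `&` V !=set0.

Definition totally_G_transitive (G : topologicalGroupType) (X : gSpaceType G)
    (f : X -> X) : Prop :=
  forall n : nat, (1 <= n)%N -> G_transitive (iter n f).

(* Main.v *)
Require Import Defs.
From HB Require Import structures.
From mathcomp Require Import all_boot.
From mathcomp Require Import all_classical topology.

Theorem proposition2p9 (G : topologicalGroupType) (X : gSpaceType G)
    (f : X -> X) (f_continuous : continuous f)
    (f_mixing : strongly_G_mixing f) : totally_G_transitive f.
Proof.
move=> n n_gt0 U V oU U0 oV V0.
have [N N_gt0 mixN] := f_mixing U V oU U0 oV V0.
(* Mixing covers every time from [N] on. The time [N * n] qualifies because [n] is at least 1, and
   as a multiple of [n] it is also reached by iterating [iter n f]. *)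
have [g gUV] := mixN (N * n)%N (leq_pmulr N n_gt0).
(* The threshold [N] itself serves as the number of iterations of [iter n f]; [N_gt0] provides the
   positivity that transitivity demands. *)
exists g, N; split=> //.
suff -> : iter N (iter n f) = iter (N * n) f by [].
by apply/funext => x; rewrite iterM.
Qed.
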